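(* Let $G$ be a connected cograph with at least two vertices. Let $k$ be the number of nontrivial connected components of $\overline{G}$ and $t$ the number of trivial connected components of $\overline{G}$. Then: (i) if $k = 0$, then $h(G\overline{G}) = t$; (ii) if $k = 1$, letting $\overline{G}_1$ be the nontrivial component of $\overline{G}$ and $G_1$ the subgraph of $G$ induced by the vertices corresponding to $V(\overline{G}_1)$, we have $t+2 \leq h(G\overline{G}) \leq \min\{h(G_1), h(\overline{G}_1)\} + t$; (iii) if $k \geq 2$, then $h(G\overline{G}) = k + t + 1$.
   Context: All graphs are finite, simple and undirected. A cograph is a graph with no induced path on four vertices. For a graph $H$ and $x,y \in V(H)$, the closed interval $I[x,y]$ consists of $x$, $y$ and all vertices lying on some shortest path between $x$ and $y$ in $H$; for $S \subseteq V(H)$, $I[S] = \bigcup_{x,y\in S} I[x,y]$. A set $S$ is (geodetically) convex if $I[S]=S$; the convex hull $H(S)$ is the smallest convex set containing $S$; $S$ is a hull set if $H(S)=V(H)$; the (geodetic) hull number $h(H)$ is the minimum cardinality of a hull set of $H$ (hull numbers of $G_1$, $\overline{G}_1$ are taken in those graphs on their own). For a graph $G$ with vertex set $\{v_1,\dots,v_n\}$, the complementary prism $G\overline{G}$ has vertex set $\{v_1,\dots,v_n\}\cup\{\overline{v}_1,\dots,\overline{v}_n\}$ and edge set $E(G) \cup \{\overline{v}_i\overline{v}_j : i<j,\ v_iv_j\notin E(G)\} \cup \{v_i\overline{v}_i : 1\le i\le n\}$; $v_i$ and $\overline{v}_i$ are corresponding vertices. A component is trivial if it has exactly one vertex, nontrivial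 otherwise. *)

(* Defs.v *)
From HB Require Import structures.
From mathcomp Require Import all_boot.

Set Implicit Arguments.
Unset Strict Implicit.
Unset Printing Implicit Defensive.

Record sgraph := SGraph {
  vertex :> finType;
  adj : rel vertex;
  adj_sym : symmetric adj;
  adj_irr : irreflexive adj }.

Section Constructions.
Variable G : sgraph.

Definition compl_adj : rel G := fun x y => (x != y) && ~~ adj x y.

Lemma compl_adj_sym : symmetric compl_adj.
Proof. by move=> x y; rewrite /compl_adj eq_sym (adj_sym x y). Qed.

Lemma compl_adj_irr : irreflexive compl_adj.
Proof. by move=> x; rewrite /compl_adj eqxx. Qed.

Definition compl : sgraph := SGraph compl_adj_sym compl_adj_irr.

Definition induced_adj (C : {set G}) : rel {x : G | x \in C} :=
  fun x y => adj (val x) (val y).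

Lemma induced_adj_sym C : symmetric (@induced_adj C).
Proof. by move=> x y; apply: adj_sym. Qed.

Lemma induced_adj_irr C : irreflexive (@induced_adj C).
Proof. by move=> x; apply: adj_irr. Qed.

Definition induced (C : {set G}) : sgraph :=
  SGraph (@induced_adj_sym C) (@induced_adj_irr C).

(* [inl v] is the vertex v of G, [inr v] is the corresponding vertex of the
   complement. *)
Definition cprism_adj : rel (G + G)%type := fun u v =>
  match u, v with
  | inl x, inl y => adj x y
  | inr x, inr y => compl_adj x y
  | inl x, inr y | inr x, inl y => x == y
  end.

Lemma cprism_adj_sym : symmetric cprism_adj.
Proof.
move=> [x|x] [y|y] /=; [exact: adj_sym | exact: eq_sym | exact: eq_sym |].
exact: compl_adj_sym.
Qed.

Lemma cprism_adj_irr : irreflexive cprism_adj.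
Proof. by case=> x; [apply: adj_irr | apply: compl_adj_irr]. Qed.

Definition cprism : sgraph := SGraph cprism_adj_sym cprism_adj_irr.

End Constructions.

Arguments induced G C : clear implicits.

Section Connectivity.
Variable G : sgraph.

Definition connected : Prop := forall x y : G, connect (@adj G) x y.

Definition components : {set {set G}} :=
  [set [set y | connect (@adj G) x y] | x : G].

Definition nontrivial_components : {set {set G}} :=
  [set C in components | 1 < #|C|].

Definition trivial_components : {set {set G}} :=
  [set C in components | #|C| == 1].

Definition cograph : Prop :=
  ~ exists2 f : 'I_4 -> G, injective f &
      forall i j : 'I_4, adj (f i) (f j) = (i.+1 == j) || (j.+1 == i).

End Connectivity.

Section Geodetic.
Variable G : sgraph.

(* [x :: p] is the vertex sequence of a path from x to y; its length is
   [size p]. *)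
Definition gpath (x y : G) (p : seq G) : bool :=
  [&& path (@adj G) x p, last x p == y & uniq (x :: p)].

Definition shortest_gpath (x y : G) (p : seq G) : bool :=
  gpath x y p &&
  [forall n : 'I_(size p), forall q : n.-tuple G, ~~ gpath x y q].

(* As the vertices of a path are distinct, its length is less than #|G|. *)
Definition interval (x y : G) : {set G} :=
  [set x; y] :|:
  [set z | [exists n : 'I_#|G|, exists p : n.-tuple G,
              shortest_gpath x y p && (z \in x :: p)]].

Definition interval_set (S : {set G}) : {set G} :=
  \bigcup_(x in S) \bigcup_(y in S) interval x y.

Definition convex (S : {set G}) : bool := interval_set S == S.

Definition hull (S : {set G}) : {set G} :=
  \bigcap_(C : {set G} | convex C && (S \subset C)) C.

Definition hull_set (S : {set G}) : bool := hull S == [set: G].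

(* [set: G] is always a hull set, so the minimum is over a nonempty family. *)
Definition hull_number : nat :=
  #|[arg min_(S < [set: G] | hull_set S) #|S|]|.

End Geodetic.

(* Main.v *)
Require Import Defs.
From mathcomp Require Import all_boot.

(* In the prism, two vertices of G are at distance at most 2, two vertices of the
   complement lying in one co-component (a component of the complement of G) are
   at distance at most 2, and if x, y lie in different co-components the only
   geodesic between their copies in the complement runs through x and y.  Hence
   convexity in the prism reduces to five closure rules (cprism_convexP).

   Lower bounds: deleting the complement copy of one co-component leaves a convex
   set, so a hull set meets each of these copies, and when some co-component is
   nontrivial one vertex per copy is not enough.  Upper bounds: once all of G is
   in the hull, each co-component fills up from any one of its vertices. *)

(** * Induced paths and connectivity in cographs *)

Lemma connect_closed (T : finType) (e : rel T) (P : pred T) x y :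
  (forall a b, P a -> e a b -> P b) -> P x -> connect e x y -> P y.
Proof.
move=> Pe Px /connectP[p]; elim: p x Px => [|a p IH] x Px /=; first by move=> _ ->.
by case/andP=> exa pa yE; apply: IH pa yE; apply: Pe exa.
Qed.

Lemma sgraph_connect_sym (H : sgraph) : connect_sym (@adj H).
Proof. by apply: sym_connect_sym => x y; apply: adj_sym. Qed.

Lemma adj_neq (H : sgraph) (x y : H) : adj x y -> x != y.
Proof. by apply: contraTneq => ->; rewrite adj_irr. Qed.

(** Distinctness of the four vertices comes for free: consecutive ones are adjacent, and identifying
    two others would turn one of the edges into a forbidden adjacency. *)
Lemma cograph_no_P4 (H : sgraph) (a b c d : H) : cograph H ->
  adj a b -> adj b c -> adj c d -> ~~ adj a c -> ~~ adj b d -> ~~ adj a d -> False.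
Proof.
move=> cH ab bc cd /negbTE nac /negbTE nbd /negbTE nad; apply: cH.
pose s := [:: a; b; c; d].
have us : uniq s.
  have neac : a != c by apply: contraTneq cd => <-; rewrite nad.
  have nebd : b != d by apply: contraTneq ab => ->; rewrite nad.
  have nead : a != d by apply: contraTneq ab => ->; rewrite adj_sym nbd.
  rewrite /= !inE !negb_or neac nebd nead (adj_neq _ _ _ ab) (adj_neq _ _ _ bc).
  by rewrite (adj_neq _ _ _ cd).
exists (fun i : 'I_4 => nth a s i).
  move=> i j /eqP; rewrite nth_uniq //; first by move/eqP/val_inj.
case=> [[|[|[|[|i]]]] // ?] [[|[|[|[|j]]]] // ?] /=;
  by rewrite ?adj_irr ?(ab, bc, cd, nac, nbd, nad) // adj_sym ?(ab, bc, cd, nac, nbd, nad).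
Qed.

(** The path on four vertices is self-complementary: the complement of 0-1-2-3 is 1-3-0-2, which
    gives the order of the vertices below. *)
Lemma cograph_compl (H : sgraph) : cograph H -> cograph (compl H).
Proof.
move=> cH [f fI fP].
have fA i j : i != j -> @adj H (f i) (f j) = ~~ ((i.+1 == j) || (j.+1 == i)).
  by move=> ij; rewrite -fP /= /compl_adj (inj_eq fI) ij /= negbK.
pose o i (h : i < 4) : 'I_4 := Ordinal h.
by apply: (@cograph_no_P4 H (f (@o 1 isT)) (f (@o 3 isT)) (f (@o 0 isT)) (f (@o 2 isT)));
  rewrite // fA.
Qed.

Lemma cograph_induced (H : sgraph) (C : {set H}) :
  cograph H -> cograph (induced H C).
Proof.
move=> cH [f fI fP]; apply: cH; exists (fun i => val (f i)) => //.
by move=> i j /val_inj/fI.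
Qed.

(** Components of a cograph have diameter at most 2: prolonging an induced path of length 2 by an
    edge yields a shortcut, since otherwise an induced path on four vertices would appear. *)
Lemma cograph_connect (H : sgraph) (x y : H) : cograph H ->
  connect (@adj H) x y ->
  [|| x == y, adj x y | [exists z, adj x z && adj z y]].
Proof.
move=> cH; apply: (connect_closed _ _
  (fun y => [|| x == y, adj x y | [exists z, adj x z && adj z y]])); last by rewrite eqxx.
move=> a b; case: (boolP (x == b)) => //= nxb; case: (boolP (adj x b)) => //= axb.
case/or3P=> [/eqP xa ab | xa ab | /existsP[z /andP[xz za]] ab].
- by rewrite xa ab in axb.
- by apply/existsP; exists a; rewrite xa.
apply/existsP; case: (boolP (adj z b)) => zb; first by exists z; rewrite xz.
case: (boolP (adj x a)) => xa; first by exists a; rewrite xa.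
by case: (cograph_no_P4 _ _ _ _ _ cH xz za ab xa zb axb).
Qed.

(* Seinsche's theorem.  A set A maximal among the co-disconnected vertex sets
   is a union of components: a vertex v outside A with a neighbour in A would
   give an induced path y - c - x - v, where x, y lie in one co-component of A
   and c in another. *)
Lemma cograph_compl_disconnected (H : sgraph) : cograph H -> connected H ->
  1 < #|H| -> ~ connected (compl H).
Proof.
move=> cH coH H2 coC.
(* [A] splits into nonempty parts [B] and [A :\: B] with all edges of [H] between them. *)
pose codisc (A : {set H}) := [exists B : {set H}, [&& B \proper A, B != set0 &
  [forall x in B, forall y in A :\: B, adj x y]]].
have codiscP (A B : {set H}) : B \proper A -> B != set0 ->
    (forall x y, x \in B -> y \in A :\: B -> adj x y) -> codisc A.
  move=> BA B0 Badj; apply/existsP; exists B; rewrite BA B0 /=.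
  by apply/forall_inP=> x xB; apply/forall_inP=> y; apply: Badj.
have [u [w uw]] : exists u w : H, adj u w.
  case/card_gt1P: H2 => u [w [_ _ uw]].
  case/connectP: (coH u w) uw => [[|v p]] /=; first by move=> _ ->; rewrite eqxx.
  by case/andP=> uv _ _ _; exists u, v.
have cd0 : codisc [set u; w].
  apply: (codiscP _ [set u]).
  - apply/properP; split; first by apply/subsetP=> x; rewrite !inE => ->.
    by exists w; rewrite !inE ?eqxx ?orbT // eq_sym (adj_neq _ _ _ uw).
  - by apply/set0Pn; exists u; rewrite inE.
  - by move=> x y; rewrite !inE => /eqP-> /andP[/negbTE-> /= /eqP->].
have [A /maxsetP[cdA maxA] _] := maxset_exists cd0.
(* If [A] is everything, [B] is closed under co-adjacency, so the complement is not connected. *)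
have [AT|] := boolP (A == setT).
  move/eqP: AT => AT; subst A; case/existsP: cdA => B /and3P[/properP[_ [y _ yB]]].
  case/set0Pn=> x xB /forall_inP Badj.
  suff: y \in B by rewrite (negbTE yB).
  apply: (connect_closed _ _ (mem B) _ _ _ xB (coC x y)) => a b aB /andP[_].
  apply: contraR => bB; have /forall_inP := Badj a aB; apply.
  by rewrite !inE bB.
rewrite -subTset => /subsetPn[v _ vA].
have [a aA] : exists a, a \in A by case/existsP: cdA => B /and3P[/properP[_ [y yA _]] _ _]; exists y.
have [a' [v' [aA' vA' av']]] : exists a v, [/\ a \in A, v \notin A & adj a v].
  case: (boolP [exists a in A, exists v, (v \notin A) && adj a v]).
    by case/exists_inP=> a' a'A /existsP[v' /andP[]]; exists a', v'.
  move=> nex; suff: v \in A by rewrite (negbTE vA).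
  apply: (connect_closed _ _ (mem A) _ _ _ aA (coH a v)) => x y /= xA xy.
  apply: contraR nex => yA; apply/exists_inP; exists x => //.
  by apply/existsP; exists y; rewrite yA.
move: {a v aA vA} a' v' aA' vA' av' => a v aA vA av.
pose eA : rel H := fun x y => [&& x \in A, y \in A & @adj (compl H) x y].
pose B := [set x | connect eA a x].
have BA : B \subset A.
  apply/subsetP=> x; rewrite inE; apply: connect_closed => //.
  by move=> b c _ /and3P[].
have aB : a \in B by rewrite inE.
have Badj x y : x \in B -> y \in A :\: B -> adj x y.
  move=> xB; rewrite !inE => /andP[yB yA]; apply: contraR yB => nxy.
  have xA := subsetP BA _ xB; rewrite inE in xB.
  case: (eqVneq x y) => [<-//|nexy].
  apply: connect_trans xB (connect1 _).
  by rewrite /eA xA yA /= /compl_adj nexy.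
have [c cA cB] : exists2 c, c \in A & c \notin B.
  case/existsP: cdA => D /and3P[/properP[DA [y yA yD]] /set0Pn[x xD] /forall_inP Dadj].
  (* The co-component of [a] inside [A] cannot cross the split of [A] into [D] and [A :\: D], so it
     misses a vertex of [A]. *)
  have step (P : pred H) : (forall b d, b \in A -> d \in A -> ~~ @adj H b d -> P b -> P d) -> P a ->
      forall b, b \in B -> P b.
    move=> Pst Pa b; rewrite inE.
    apply: (connect_closed _ _ P) => // b1 d Pb.
    by case/and3P=> bA dA /andP[_ nadj]; apply: Pst Pb.
  have xA := subsetP DA _ xD.
  case: (boolP (a \in D)) => aD.
    exists y => //; apply: contra yD; apply: (step (mem D)) => // b d bA dA nbd bD.
    apply: contraR nbd => dD; have /forall_inP := Dadj b bD; apply.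
    by rewrite inE dA dD.
  exists x => //; apply: contraL xD; apply: (step (fun x => x \notin D)) => // b d bA dA nbd bD.
  apply: contra nbd => dD; have /forall_inP := Dadj d dD; rewrite adj_sym; apply.
  by rewrite inE bA bD.
have ncd : ~~ codisc (v |: A).
  apply: contra vA => /maxA <-; first by rewrite setU11.
  by rewrite subsetUr.
(* Otherwise [B] would be joined to all the rest of [v |: A], against maximality; the same argument
   with [A :\: B] gives [c']. *)
have [b bB nbv] : exists2 b, b \in B & ~~ adj b v.
  apply/exists_inP; apply: contraR ncd; rewrite negb_exists_in => /forall_inP hB.
  apply: (codiscP _ B).
  - apply/properP; split; first by apply: subset_trans BA (subsetUr _ _).
    by exists c => //; rewrite inE cA orbT.
  - by apply/set0Pn; exists a.
  - move=> x y xB; rewrite !inE => /andP[yB /orP[/eqP->|yA]].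
      by move/negPn: (hB x xB).
    by apply: Badj => //; rewrite in_setD yA andbT inE.
have [c' [c'A c'B nc'v]] : exists c', [/\ c' \in A, c' \notin B & ~~ adj c' v].
  case: (boolP [exists c' in A :\: B, ~~ adj c' v]).
    by case/exists_inP=> c'; rewrite inE => /andP[]; exists c'.
  rewrite negb_exists_in => /forall_inP hC; case/negP: ncd.
  apply: (codiscP _ (A :\: B)).
  - apply/properP; split; first by apply/subsetP=> x; rewrite !inE => /andP[_ ->]; rewrite orbT.
    by exists v; rewrite !inE ?eqxx // (negbTE vA) andbF.
  - by apply/set0Pn; exists c; rewrite inE cB cA.
  - move=> x y xAB; rewrite !inE => /andP[]; rewrite negb_and negbK => yB.
    case/orP=> [/eqP->|yA]; first by move/negPn: (hC x xAB).
    by rewrite adj_sym; apply: Badj => //; move: yB; rewrite yA orbF inE.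
(* On a co-path in [B] from the neighbour [a] of [v] to the non-neighbour [b], adjacency to [v] is
   lost at some step from [x] to [y]. *)
have [x [y [xB yB nxy xv nyv]]] :
    exists x y, [/\ x \in B, y \in B, ~~ @adj H x y, adj x v & ~~ adj y v].
  case: (boolP [exists x in B, exists y in B, [&& ~~ @adj H x y, adj x v & ~~ adj y v]]).
    by case/exists_inP=> x xB /exists_inP[y yB /and3P[]]; exists x, y.
  move=> nex; have: (b \in B) && adj b v; last by rewrite (negbTE nbv) andbF.
  have : connect eA a b by rewrite inE in bB.
  apply: (connect_closed _ _ (fun b => (b \in B) && adj b v)).
    move=> x y /andP[xB xv] exy.
    have yB : y \in B by move: xB; rewrite !inE => /connect_trans; apply; apply: connect1.
    rewrite yB; apply: contraR nex => nyv; apply/exists_inP; exists x => //.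
    apply/exists_inP; exists y => //; rewrite xv nyv !andbT.
    by case/and3P: exy => _ _ /andP[].
  by rewrite aB.
have c'AB : c' \in A :\: B by rewrite inE c'A c'B.
apply: (cograph_no_P4 H y c' x v cH) => //; try exact: Badj.
- by rewrite adj_sym; apply: Badj.
- by rewrite adj_sym.
Qed.

(** * Geodesics, intervals, convexity and hull sets *)

Lemma gpath_edge (H : sgraph) (x y : H) : adj x y -> gpath x y [:: y].
Proof. by move=> xy; rewrite /gpath /= xy eqxx !inE (adj_neq _ _ _ xy). Qed.

Lemma gpath_two (H : sgraph) (x y z : H) :
  x != y -> adj x z -> adj z y -> gpath x y [:: z; y].
Proof.
move=> nxy xz zy; rewrite /gpath /= xz zy eqxx !inE negb_or nxy.
by rewrite (adj_neq _ _ _ xz) (adj_neq _ _ _ zy).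
Qed.

Lemma shortest_gpath_min (H : sgraph) (x y : H) p q :
  shortest_gpath x y p -> gpath x y q -> size p <= size q.
Proof.
case/andP=> _ /forallP hp gq; rewrite leqNgt; apply/negP=> lt.
have /forallP/(_ (in_tuple q)) := hp (Ordinal lt).
by rewrite gq.
Qed.

Lemma shortest_gpathI (H : sgraph) (x y : H) p : gpath x y p ->
  (forall q, gpath x y q -> size p <= size q) -> shortest_gpath x y p.
Proof.
move=> gp min; rewrite /shortest_gpath gp /=; apply/forallP=> n; apply/forallP=> q.
by apply/negP=> /min; rewrite size_tuple leqNgt ltn_ord.
Qed.

Lemma intervalP (H : sgraph) (x y z : H) : reflect
  (z = x \/ z = y \/ exists2 p, shortest_gpath x y p & z \in x :: p)
  (z \in interval x y).
Proof.
apply: (iffP idP).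
  rewrite !inE -orbA => /or3P[/eqP->|/eqP->|]; [by left|by right; left|].
  by case/existsP=> n /existsP[p /andP[sp zp]]; right; right; exists (tval p).
rewrite !inE; case=> [->|[->|[p sp zp]]]; rewrite ?eqxx ?orbT //.
apply/orP; right.
have lt : size p < #|H|.
  case/andP: (sp) => /and3P[_ _ up] _; have := max_card (mem (x :: p)).
  by rewrite (card_uniqP up).
by apply/existsP; exists (Ordinal lt); apply/existsP; exists (in_tuple p); rewrite sp.
Qed.

Lemma convexP (H : sgraph) (S : {set H}) : reflect
  (forall x y z, x \in S -> y \in S -> z \in interval x y -> z \in S) (convex S).
Proof.
apply: (iffP eqP) => [eS x y z xS yS zi | hS].
  by rewrite -eS; apply/bigcupP; exists x => //; apply/bigcupP; exists y.
apply/eqP; rewrite eqEsubset; apply/andP; split; apply/subsetP=> z.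
  by case/bigcupP=> x xS /bigcupP[y yS]; apply: hS.
move=> zS; apply/bigcupP; exists z => //; apply/bigcupP; exists z => //.
by apply/intervalP; left.
Qed.

Lemma mem_interval_two (H : sgraph) (x y z : H) :
  x != y -> ~~ adj x y -> adj x z -> adj z y -> z \in interval x y.
Proof.
move=> nxy axy xz zy; apply/intervalP; right; right; exists [:: z; y]; last by rewrite !inE eqxx orbT.
apply: shortest_gpathI; first exact: gpath_two.
case=> [|a [|b q]] //; rewrite /gpath /=; first by rewrite (negbTE nxy).
by case/and3P=> /andP[xa _] /eqP ay _; rewrite -ay xa in axy.
Qed.

(** A geodesic is no longer than [q], so besides the endpoints only the middle vertex of a geodesic
    of length two can occur. *)
Lemma interval_le2 (H : sgraph) (x y z : H) q :
  gpath x y q -> size q <= 2 -> z \in interval x y ->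
  [\/ z = x, z = y | [/\ x != y, ~~ adj x y, adj x z & adj z y]].
Proof.
move=> gq sq /intervalP[->|[->|[p sp zp]]]; [by constructor 1|by constructor 2|].
have sp2 := leq_trans (shortest_gpath_min _ _ _ _ _ sp gq) sq.
have gp : gpath x y p by case/andP: sp.
case: p sp zp sp2 gp => [|a [|b [|]]] //= sp; rewrite !inE.
- by move=> /eqP->; constructor 1.
- move=> h _ /and3P[_ /= /eqP ay _]; subst a.
  by case/orP: h => /eqP->; [constructor 1|constructor 2].
move=> h _ /and3P[/= /and3P[xa ab _] /eqP bY /= /andP[]]; subst b.
rewrite !inE negb_or => /andP[_ nxy] _.
case/or3P: h => /eqP->; [by constructor 1| |by constructor 2].
constructor 3; split=> //; apply/negP=> xy.
by have := shortest_gpath_min _ _ _ _ _ sp (gpath_edge _ _ _ xy).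
Qed.

Lemma cograph_gpath (H : sgraph) (x y : H) : cograph H ->
  connect (@adj H) x y -> exists2 q, gpath x y q & size q <= 2.
Proof.
move=> cH /(cograph_connect _ _ _ cH); case: (eqVneq x y) => /= [->|nxy].
  by exists [::] => //; rewrite /gpath /= eqxx.
case/orP=> [xy|/existsP[w /andP[xw wy]]].
  by exists [:: y] => //; apply: gpath_edge.
by exists [:: w; y] => //; apply: gpath_two.
Qed.

(** Vertices joined by a path are at distance at most 2, and between disconnected ones the interval
    consists of the endpoints alone. *)
Lemma cograph_convex (H : sgraph) (S : {set H}) : cograph H ->
  (forall x y z, x \in S -> y \in S -> x != y -> ~~ adj x y -> adj x z ->
     adj z y -> z \in S) -> convex S.
Proof.
move=> cH hS; apply/convexP=> x y z xS yS zi.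
case/intervalP: (zi) => [->//|[->//|[p /andP[/and3P[xp /eqP lp _] _] _]]].
have [|q gq sq] := cograph_gpath _ x y cH; first by apply/connectP; exists p.
by case: (interval_le2 _ _ _ _ _ gq sq zi) => [->|->|[]] //; apply: hS.
Qed.

Lemma hull_setP (H : sgraph) (S : {set H}) : reflect
  (forall T : {set H}, convex T -> S \subset T -> forall x, x \in T) (hull_set S).
Proof.
apply: (iffP eqP) => [hS T cT ST x|hS].
  have: x \in hull S by rewrite hS.
  by move/bigcapP; apply; rewrite cT.
apply/setP=> x; rewrite [RHS]inE; apply/bigcapP=> T /andP[cT ST]; exact: hS.
Qed.

Lemma hull_setT (H : sgraph) : hull_set [set: H].
Proof. by apply/hull_setP=> T _ /subsetP sT x; apply: sT. Qed.

Lemma hull_number_le (H : sgraph) (S : {set H}) : hull_set S -> hull_number H <= #|S|.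
Proof.
by move=> hS; rewrite /hull_number; case: arg_minnP => [|T _]; [apply: hull_setT|apply].
Qed.

Lemma hull_number_attained (H : sgraph) :
  exists2 S : {set H}, hull_set S & #|S| = hull_number H.
Proof.
rewrite /hull_number; case: arg_minnP => [|T hT _]; first exact: hull_setT.
by exists T.
Qed.

(** * Geodesics and convexity in the complementary prism *)

Section ComplementaryPrism.
Variable G : sgraph.
Hypotheses (coG : connected G) (cG : cograph G).

Let co (x y : G) := connect (@adj (compl G)) x y.

Lemma adj_of_not_coconnected (x y : G) : ~~ co x y -> adj x y.
Proof.
apply: contraR => nxy; case: (eqVneq x y) => [->|nexy]; first exact: connect0.
by apply: connect1; rewrite /= /compl_adj nexy.
Qed.

Let inl_eq (x y : G) : (inl x == inl y :> cprism G) = (x == y). Proof. by []. Qed.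
Let inr_eq (x y : G) : (inr x == inr y :> cprism G) = (x == y). Proof. by []. Qed.

(** A path of length at most 2 would either stay in the complement, contradicting [~~ co x y], or
    visit a single vertex of [G], forcing [x = y]. *)
Lemma gpath_inr_apart (x y : G) : ~~ co x y ->
  @shortest_gpath (cprism G) (inr x) (inr y) [:: inl x; inl y; inr y].
Proof.
move=> nco; have xy := adj_of_not_coconnected _ _ nco; have nxy := adj_neq _ _ _ xy.
apply: shortest_gpathI.
  by rewrite /gpath /= !eqxx xy !inE inl_eq inr_eq !negb_or nxy.
case=> [|a [|b [|c q]]] //; rewrite /gpath /=.
- by rewrite inr_eq (negbTE nxy).
- case/and3P=> /andP[xa _] /eqP aE _; rewrite aE /= in xa.
  by rewrite (_ : co x y) // in nco; apply: connect1.
- case/and3P=> /and3P[xa ab _] /eqP bE _; rewrite {b}bE in ab.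
  case: a xa ab => a /=; first by move=> /eqP<- /eqP xy'; rewrite xy' eqxx in nxy.
  move=> xa ay; case/negP: nco.
  by apply: connect_trans (connect1 _) (connect1 ay).
Qed.

Lemma interval_inr_apart (x y : G) (z : cprism G) : ~~ co x y ->
  z \in @interval (cprism G) (inr x) (inr y) ->
  z \in [:: inr x; inl x; inl y; inr y].
Proof.
move=> nco /intervalP[->|[->|[p sp]]]; rewrite ?inE ?eqxx ?orbT //.
have := shortest_gpath_min _ _ _ _ _ sp (proj1 (andP (gpath_inr_apart _ _ nco))).
case/andP: sp => /and3P[+ + _] _; case: p => [|a [|b [|c [|]]]] //=.
- by move=> _ _ _ /orP[->|].
- by move=> _ /eqP-> _; rewrite !inE => /orP[]->; rewrite ?orbT.
- case/and3P=> xa ab _ /eqP bE _; rewrite {b}bE in ab *.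
  case: a xa ab => a /=; last first.
    move=> xa ay; case/negP: nco; exact: connect_trans (connect1 _) (connect1 ay).
  by move=> /eqP<- _; rewrite !inE => /or3P[]->; rewrite ?orbT.
case/and4P=> xa ab bc _ /eqP cE _; rewrite {c}cE in bc *.
(* If both inner vertices lie in [G], they must be [inl x] and [inl y]; every other placement
   connects [x] to [y] in the complement. *)
case: a xa ab => a /= xa; case: b bc => b /= bY ab.
- by rewrite (eqP xa) -(eqP bY) !inE.
- move: nco; rewrite (eqP xa) (eqP ab) => /negP[]; exact: connect1.
- move: nco; rewrite -(eqP bY) -(eqP ab) => /negP[]; exact: connect1.
case/negP: nco; apply: connect_trans (connect_trans (connect1 xa) (connect1 _)) (connect1 bY).
exact: ab.
Qed.

(** Rules 1 and 4 add common neighbours within [G] and within the complement. Rules 2 and 3 treat a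
    mixed pair [inl x], [inr y], whose only possible common neighbours are [inl y] and [inr x]. Rule
    5 is the geodesic of length 3; exchanging [x] and [y] gives its other inner vertex. *)
Lemma cprism_convexP (S : {set cprism G}) : reflect
  [/\ forall x y z, inl x \in S -> inl y \in S -> x != y -> ~~ @adj G x y ->
        adj x z -> adj z y -> inl z \in S,
      forall x y, inl x \in S -> inr y \in S -> @adj G x y -> inl y \in S,
      forall x y, inl x \in S -> inr y \in S -> compl_adj x y -> inr x \in S,
      forall x y z, inr x \in S -> inr y \in S -> @adj G x y ->
        compl_adj x z -> compl_adj z y -> inr z \in S
    & forall x y, inr x \in S -> inr y \in S -> ~~ co x y -> inl x \in S]
  (convex S).
Proof.
apply: (iffP (convexP _ _)) => [hS|[h1 h2 h3 h4 h5] u v w].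
  split.
  - by move=> x y z xS yS nxy nadj xz zy; apply: hS xS yS _; apply: mem_interval_two.
  - move=> x y xS yS xy; apply: hS xS yS _; apply: mem_interval_two => //=.
    exact: (adj_neq _ _ _ xy).
  - move=> x y xS yS xy; apply: hS xS yS _; apply: mem_interval_two => //=.
    by case/andP: xy.
  - move=> x y z xS yS xy xz zy; apply: hS xS yS _; apply: mem_interval_two => //=.
      exact: (adj_neq _ _ _ xy).
    by rewrite /compl_adj xy andbF.
  - move=> x y xS yS nco; apply: hS xS yS _; apply/intervalP; right; right.
    by exists [:: inl x; inl y; inr y]; rewrite ?gpath_inr_apart // !inE eqxx orbT.
have mixed x y z : inl x \in S -> inr y \in S ->
    @cprism_adj G (inl x) z -> @cprism_adj G z (inr y) -> x != y -> z \in S.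
  case: z => z /= xS yS xz zy nxy.
    by move: xz; rewrite (eqP zy); apply: h2.
  by move: zy; rewrite -(eqP xz); apply: h3.
have mixedp x y : x != y -> exists z, @cprism_adj G (inl x) z && @cprism_adj G z (inr y).
  move=> nxy; case: (boolP (adj x y)) => xy; [exists (inl y)|exists (inr x)];
    by rewrite /= ?xy ?eqxx // /compl_adj nxy.
case: u => x; case: v => y xS yS.
- have [q gq sq] := cograph_gpath _ x y cG (coG x y).
  have gq' : @gpath (cprism G) (inl x) (inl y) (map inl q).
    move: gq; rewrite /gpath -map_cons (map_inj_uniq (@inl_inj _ _)) last_map.
    rewrite (inj_eq (@inl_inj _ _)) => /and3P[pq -> ->]; rewrite !andbT.
    by rewrite path_map.
  move/(interval_le2 _ _ _ _ _ gq'); rewrite size_map => /(_ sq)[->|->|[]] //=.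
  case: w => w /=; first by apply: h1.
  by move=> nxy _ /eqP xw /eqP wy; rewrite xw wy eqxx in nxy.
- case: (eqVneq x y) => [exy|nxy].
    have e : @adj (cprism G) (inl x) (inr y) by rewrite /= exy.
    by case/(interval_le2 _ _ _ _ _ (gpath_edge _ _ _ e) isT) => [->|->|[_ /negP[]]].
  have [z /andP[xz zy]] := mixedp _ _ nxy.
  case/(interval_le2 _ _ _ _ _ (gpath_two (cprism G) (inl x) (inr y) z isT xz zy) isT) => [->|->|[]] //.
  by move=> _ _ xw wy; apply: mixed xw wy nxy.
- case: (eqVneq y x) => [exy|nxy].
    have e : @adj (cprism G) (inr x) (inl y) by rewrite /= exy.
    by case/(interval_le2 _ _ _ _ _ (gpath_edge _ _ _ e) isT) => [->|->|[_ /negP[]]].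
  have [z /andP[xz zy]] := mixedp _ _ nxy.
  rewrite cprism_adj_sym in xz; rewrite cprism_adj_sym in zy.
  case/(interval_le2 _ _ _ _ _ (gpath_two (cprism G) (inr x) (inl y) z isT zy xz) isT) => [->|->|[]] //.
  by move=> _ _ xw wy; apply: (mixed y x) => //; rewrite cprism_adj_sym.
case: (boolP (co x y)) => [cxy|nco]; last first.
  move/(interval_inr_apart _ _ _ nco); rewrite !inE => /or4P[] /eqP-> //.
    exact: h5 nco.
  by apply: (h5 y x) => //; rewrite /co sgraph_connect_sym.
have [q gq sq] := cograph_gpath _ _ _ (cograph_compl _ cG) cxy.
have gq' : @gpath (cprism G) (inr x) (inr y) (map inr q).
  move: gq; rewrite /gpath -map_cons (map_inj_uniq (@inr_inj _ _)) last_map.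
  rewrite (inj_eq (@inr_inj _ _)) => /and3P[pq -> ->]; rewrite !andbT.
  by rewrite path_map.
move/(interval_le2 _ _ _ _ _ gq'); rewrite size_map => /(_ sq)[->|->|[]] //=.
case: w => w /=; first by move=> nxy _ /eqP xw /eqP wy; rewrite xw wy eqxx in nxy.
move=> nxy; rewrite /compl_adj -[_ == _]/(x == y) in nxy *; rewrite nxy negbK => xy xw wy.
exact: h4 xy xw wy.
Qed.

(** * Co-components and lower bounds *)

Let cocomp (x : G) : {set G} := [set y | co x y].

Lemma cocompE (x y : G) : (cocomp x == cocomp y) = co x y.
Proof.
apply/eqP/idP=> [e|xy].
  have: y \in cocomp y by rewrite inE /co connect0.
  by rewrite -e inE.
by apply/setP=> z; rewrite !inE /co (same_connect (sgraph_connect_sym (compl G)) xy).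
Qed.

Lemma card_components :
  #|nontrivial_components (compl G)| + #|trivial_components (compl G)|
  = #|components (compl G)|.
Proof.
rewrite -[RHS](cardsID (nontrivial_components (compl G))); congr (_ + _);
  apply: eq_card => C; rewrite !inE.
  by case: (C \in _); rewrite //= andbF.
case: (boolP (C \in components _)) => [/imsetP[x _ ->]|_]; last by rewrite andbF.
rewrite /= andbT -leqNgt eqn_leq [0 < _](_ : _ = true) ?andbT //.
by apply/card_gt0P; exists x; rewrite inE connect0.
Qed.

Lemma codegree_gt0 (x : G) : 1 < #|cocomp x| -> exists y, compl_adj x y.
Proof.
case/card_gt1P=> a [b [ax bx nab]].
have [c cx ncx] : exists2 c, co x c & x != c.
  case: (eqVneq x a) => [xa|nxa].
    by exists b; [rewrite inE in bx | rewrite xa].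
  by exists a => //; rewrite inE in ax.
case/connectP: cx ncx => [[|y p]] /=; first by move=> _ ->; rewrite eqxx.
by case/andP=> xy _ _ _; exists y.
Qed.

(** Only rules 3 and 4 add copies in the complement, and each new copy is co-adjacent to one already
    present, hence lies in the same co-component. *)
Lemma convex_minus_cocomp (a : G) :
  convex (~: [set inr x | x in cocomp a] : {set cprism G}).
Proof.
have inrE x : (inr x \in [set inr x | x in cocomp a]) = co a x.
  by rewrite mem_imset ?inE //; apply: inr_inj.
have inlS x : inl x \in ~: [set inr x | x in cocomp a].
  by rewrite inE; apply/imsetP=> [[]].
have co_adj x y : compl_adj x y -> co a x = co a y.
  move=> xy; rewrite /co; apply: same_connect_r; first exact: sgraph_connect_sym.
  exact: connect1.
apply/cprism_convexP; split=> [x y z|x y|x y|x y z|x y]; rewrite ?inlS //.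
- by rewrite ![_ \in ~: _]inE !inrE => _ + /co_adj ->.
- by rewrite ![_ \in ~: _]inE !inrE => + _ _ /co_adj <-.
Qed.

Lemma card_inr_le (S : {set cprism G}) : #|[set x : G | inr x \in S]| <= #|S|.
Proof.
rewrite -(card_imset _ (@inr_inj G G)); apply/subset_leq_card/subsetP=> u.
by case/imsetP=> x; rewrite inE => + ->.
Qed.

Lemma components_sub_hull_set (S : {set cprism G}) : hull_set S ->
  components (compl G) \subset [set cocomp x | x in [set x | inr x \in S]].
Proof.
move=> /hull_setP hS; apply/subsetP=> C /imsetP[a _ ->].
have [SC|] := boolP (S \subset ~: [set inr x | x in cocomp a]).
  have := hS _ (convex_minus_cocomp a) SC (inr a).
  by rewrite inE mem_imset ?inE /co ?connect0 //; apply: inr_inj.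
case/subsetPn=> u uS; rewrite inE negbK => /imsetP[x]; rewrite inE => ax ux.
apply/imsetP; exists x; first by rewrite inE -ux.
by apply/eqP; rewrite -/(cocomp a) cocompE.
Qed.

Lemma leq_components_hull_set (S : {set cprism G}) : hull_set S ->
  #|components (compl G)| <= #|[set x : G | inr x \in S]|.
Proof.
move=> hS; apply: leq_trans (subset_leq_card (components_sub_hull_set _ hS)) _.
exact: leq_imset_card.
Qed.

(** Distinct vertices of [X] lie in different co-components, so rules 1 and 4 never apply; the other
    rules only add copies of vertices of [X]. *)
Lemma convex_cotransversal (X : {set G}) :
  {in X &, forall x y, co x y -> x = y} ->
  convex ([set inl x | x in X] :|: [set inr x | x in X] : {set cprism G}).
Proof.
move=> hX; set S := _ :|: _.
have inlE x : (inl x \in S) = (x \in X).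
  rewrite inE mem_imset; last exact: inl_inj.
  by rewrite orbC (negbTE (_ : inl x \notin _)) //; apply/imsetP=> [[]].
have inrE x : (inr x \in S) = (x \in X).
  rewrite inE orbC mem_imset; last exact: inr_inj.
  by rewrite orbC (negbTE (_ : inr x \notin _)) //; apply/imsetP=> [[]].
apply/cprism_convexP; split=> [x y z|x y|x y|x y z|x y]; rewrite !(inlE, inrE) //.
- move=> xX yX nxy nadj; case/negP: (nxy); apply/eqP/hX => //.
  by apply: connect1; rewrite /= /compl_adj nxy.
- move=> xX yX xy xz zy; have := adj_neq _ _ _ xy; case/negP; apply/eqP/hX => //.
  by apply: connect_trans (connect1 _) (connect1 zy).
Qed.

(* If [S] had at most one vertex per co-component, it would consist of the
   copies in the complement of a transversal of the co-components, and the
   pairs of corresponding vertices over that transversal form a convex set. *)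
Lemma ltn_components_hull_set (S : {set cprism G}) :
  0 < #|nontrivial_components (compl G)| -> hull_set S ->
  #|components (compl G)| < #|S|.
Proof.
move=> k0 hS; rewrite ltnNge; apply/negP=> leS.
pose X := [set x : G | inr x \in S].
have leX : #|components (compl G)| <= #|X| := leq_components_hull_set _ hS.
have eX : #|X| = #|S|.
  by apply/eqP; rewrite eqn_leq card_inr_le (leq_trans leS).
have SE : S = [set inr x | x in X].
  apply/esym/eqP; rewrite eqEcard; apply/andP; split.
    by apply/subsetP=> u /imsetP[x]; rewrite inE => + ->.
  by rewrite card_imset ?eX //; apply: inr_inj.
(* [X] meets every co-component but has no more elements than there are co-components, so it meets
   each exactly once. *)
have injX : {in X &, injective cocomp}.
  apply/imset_injP; rewrite eqn_leq leq_imset_card /=.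
  apply: leq_trans (subset_leq_card (components_sub_hull_set _ hS)).
  by rewrite eX.
have cX : {in X &, forall x y, co x y -> x = y}.
  by move=> x y xX yX xy; apply: injX => //; apply/eqP; rewrite cocompE.
(* The convex set over [X] contains [S], so it is the whole prism and [X] is all of [G]; a
   nontrivial co-component then contains two vertices of [X]. *)
have all := hull_setP _ _ hS _ (convex_cotransversal _ cX).
have {}all x : x \in X.
  have: inr x \in [set inl x | x in X] :|: [set inr x | x in X].
    by apply: all; rewrite {1}SE subsetUr.
  case/setUP=> /imsetP[y yX] //.
  by case=> ->.
case/card_gt0P: k0 => C; rewrite inE => /andP[/imsetP[x _ ->]].
case/codegree_gt0=> y xy; have := adj_neq (compl G) x y xy.
by rewrite (cX x y) ?eqxx //; apply: connect1.
Qed.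

(** * Upper bounds from transversals of the co-components *)

Lemma cprism_spread (T : {set cprism G}) : convex T ->
  (forall x, inl x \in T) -> (forall x, exists2 r, inr r \in T & co r x) ->
  forall u, u \in T.
Proof.
move=> /cprism_convexP[_ _ h3 _ _] hl hr [x|x] //.
have [r rT] := hr x; apply: (connect_closed _ _ (fun y => inr y \in T)) => // a b aT ab.
apply: h3 aT _ => //; by rewrite compl_adj_sym.
Qed.

Lemma cotransversal_exists : exists2 X : {set G},
  #|X| <= #|components (compl G)| & forall x, exists2 r, r \in X & co r x.
Proof.
case: (pickP (@predT G)) => [x0 _|no]; last by exists set0; [rewrite cards0 | move=> x; have := no x].
pose f (C : {set G}) := odflt x0 [pick x in C].
exists (f @: components (compl G)); first exact: leq_imset_card.
move=> x; exists (f (cocomp x)); first by apply/imset_f/imset_f.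
rewrite /f; case: pickP => [y|/(_ x)]; last by rewrite inE /co connect0.
by rewrite inE /co /= (sgraph_connect_sym (compl G)).
Qed.

(** All co-components are singletons, so the whole complement side has as many vertices as there are
    co-components, and rule 5 applied to distinct vertices produces [G]. *)
Lemma hull_number_cprism_complete : 1 < #|G| ->
  #|nontrivial_components (compl G)| = 0 ->
  hull_number (cprism G) = #|trivial_components (compl G)|.
Proof.
move=> G2 k0; have := card_components; rewrite k0 add0n => ->.
have coI x y : co x y -> x = y.
  case/connectP=> [[|z p]] /=; first by move=> _ ->.
  case/andP=> xz _ _; have := in_set0 (cocomp x); rewrite -(cards0_eq k0) inE.
  rewrite imset_f //= => /negbT/negP[]; apply/card_gt1P; exists x, z.
  by rewrite !inE /co connect0 connect1 // (adj_neq (compl G) x z).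
apply/eqP; rewrite eqn_leq; apply/andP; split; last first.
  have [S hS <-] := hull_number_attained (cprism G).
  exact: leq_trans (leq_components_hull_set _ hS) (card_inr_le S).
have -> : #|components (compl G)| = #|[set inr x | x in G] : {set cprism G}|.
  rewrite [RHS]card_imset; last exact: inr_inj.
  rewrite [LHS]card_imset // => x y e; apply: coI.
  by rewrite -cocompE; apply/eqP.
apply/hull_number_le/hull_setP=> T cT /subsetP ST [x|x]; last by apply: ST; apply: imset_f.
case/cprism_convexP: cT => _ _ _ _ h5.
have [y nxy] : exists y, x != y.
  case/card_gt1P: G2 => a [b [_ _ nab]].
  by case: (eqVneq x a) => [->|]; [exists b | exists a].
by apply: (h5 x y); [apply/ST/imset_f|apply/ST/imset_f|apply: contra nxy => /coI->].
Qed.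

(** The hull set consists of the copies of a transversal and of one co-neighbour [y1] of the
    representative [r1]. Rule 5 against [r2] brings [r1] and [y1] into the hull. *)
Lemma hull_number_cprism_many : 2 <= #|nontrivial_components (compl G)| ->
  hull_number (cprism G) = #|components (compl G)| + 1.
Proof.
move=> k2; apply/eqP; rewrite eqn_leq addn1; apply/andP; split; last first.
  have [S hS <-] := hull_number_attained (cprism G).
  by apply: ltn_components_hull_set => //; apply: ltnW.
have [X cX repX] := cotransversal_exists.
case/card_gt1P: k2 => C1 [C2 []]; rewrite !inE.
case/andP=> /imsetP[a1 _ ->] C1n /andP[/imsetP[a2 _ ->] C2n].
rewrite -/(cocomp a1) -/(cocomp a2) in C1n C2n *; rewrite cocompE => n12.
have [r1 r1X r1a] := repX a1; have [r2 r2X r2a] := repX a2.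
have e1 : cocomp r1 = cocomp a1 by apply/eqP; rewrite cocompE.
have e2 : cocomp r2 = cocomp a2 by apply/eqP; rewrite cocompE.
rewrite -e1 in C1n; rewrite -e2 in C2n.
have {n12} n12 : ~~ co r1 r2 by rewrite -cocompE e1 e2 cocompE.
have [y1 r1y] := codegree_gt0 _ C1n; have [y2 r2y] := codegree_gt0 _ C2n.
have coT x y z : compl_adj x y -> ~~ co x z -> adj x z /\ adj z y.
  move=> xy nxz; split; first exact: adj_of_not_coconnected.
  rewrite adj_sym; apply: adj_of_not_coconnected; apply: contra nxz => yz.
  exact: connect_trans (connect1 _) yz.
pose S : {set cprism G} := [set inr x | x in y1 |: X].
apply: (@leq_trans #|S|); last first.
  apply: leq_trans (leq_imset_card _ _) _; rewrite cardsU1.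
  by case: (_ \notin _); rewrite ?add0n ?add1n //; apply: leqW.
apply/hull_number_le/hull_setP=> T cT /subsetP ST.
have XT x : x \in X -> inr x \in T.
  by move=> xX; apply/ST/imset_f; rewrite inE xX orbT.
apply: cprism_spread => //; last by move=> x; have [r rX] := repX x; exists r => //; apply: XT.
case/cprism_convexP: (cT) => h1 _ _ _ h5.
have r1T : inl r1 \in T by apply: (h5 r1 r2) => //; apply: XT.
have y1T : inl y1 \in T.
  apply: (h5 y1 r2) => //; [|exact: XT|].
    by apply/ST/imset_f; rewrite setU11.
  apply: contra n12; apply: connect_trans; exact: connect1.
(* A co-adjacent pair in the hull captures by rule 1 every vertex of the other co-components. The
   pair [r1], [y1] thus yields [r2] and [y2], and these capture the co-component of [r1]. *)
have far x y : inl x \in T -> inl y \in T -> compl_adj x y ->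
    forall z, ~~ co x z -> inl z \in T.
  move=> xT yT xy z nxz; have [xz zy] := coT _ _ _ xy nxz.
  by case/andP: xy => nxy nadj; apply: (h1 x y z).
have r2T : inl r2 \in T by apply: (far r1 y1).
have y2T : inl y2 \in T.
  apply: (far r1 y1) => //; apply: contra n12 => h; apply: connect_trans h _.
  by apply: connect1; rewrite /= compl_adj_sym.
move=> z; case: (boolP (co r1 z)) => [c1|]; last exact: (far r1 y1).
apply: (far r2 y2) => //; apply: contra n12 => c2; apply: connect_trans c1 _.
by rewrite sgraph_connect_sym.
Qed.

(** * Upper bounds with a single nontrivial co-component *)

Section OneNontrivialCocomponent.
Variable C : {set G}.
Hypotheses (G2 : 1 < #|G|) (CE : nontrivial_components (compl G) = [set C]).

Lemma co_outside (x y : G) : x \notin C -> co x y -> x = y.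
Proof.
move=> xC xy; apply: contraNeq xC => nxy.
have: cocomp x \in nontrivial_components (compl G).
  rewrite inE imset_f //=; apply/card_gt1P; exists x, y.
  by split; rewrite // inE //; apply: connect0.
by rewrite CE inE => /eqP <-; rewrite inE /co connect0.
Qed.

Lemma co_inside (x y : G) : x \in C -> (y \in C) = co x y.
Proof.
have : C \in nontrivial_components (compl G) by rewrite CE inE.
rewrite inE => /andP[/imsetP[a _ ->] _]; rewrite !inE => ax.
by rewrite /co (same_connect (sgraph_connect_sym (compl G)) ax).
Qed.

Lemma co_apart (x y : G) : x \in C -> y \notin C -> ~~ co x y.
Proof. by move=> xC; rewrite (co_inside x y). Qed.

Lemma card_outside : #|~: C| <= #|trivial_components (compl G)|.
Proof.
rewrite -(card_in_imset (_ : {in ~: C &, injective cocomp})).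
  apply/subset_leq_card/subsetP=> D /imsetP[x]; rewrite inE => xC ->.
  rewrite inE imset_f //=; apply/cards1P; exists x; apply/setP=> y; rewrite !inE.
  apply/idP/eqP=> [xy|->]; last exact: connect0.
  by rewrite (co_outside x y).
move=> x y; rewrite !inE => xC yC /eqP; rewrite cocompE; exact: co_outside.
Qed.

Lemma inside_neq0 : exists c, c \in C.
Proof.
have : C \in nontrivial_components (compl G) by rewrite CE inE.
by rewrite inE => /andP[/imsetP[a _ ->] _]; exists a; rewrite inE connect0.
Qed.

(** If [C] were everything, the complement would be connected, contrary to Seinsche's theorem. Such
    a vertex serves as the partner in rule 5 below. *)
Lemma outside_neq0 : exists u, u \notin C.
Proof.
case: (boolP (C == setT)) => [/eqP CT|]; last first.
  by rewrite -subTset => /subsetPn[u _ uC]; exists u.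
case: (cograph_compl_disconnected G cG coG G2) => x y.
by rewrite -/(co x y) -co_inside CT inE.
Qed.

(** A hull set of the complement on [C], together with all vertices outside [C], is placed on the
    complement side. Rule 4 fills the copy of [C], and rule 5 between [C] and its outside then gives
    all of [G]. *)
Lemma hull_number_cprism_le_compl :
  hull_number (cprism G)
  <= hull_number (induced (compl G) C) + #|trivial_components (compl G)|.
Proof.
have [S /hull_setP hS <-] := hull_number_attained (induced (compl G) C).
have [u uC] := outside_neq0.
pose X : {set G} := [set val x | x in S] :|: ~: C.
apply: (@leq_trans #|[set inr x | x in X] : {set cprism G}|); last first.
  apply: leq_trans (leq_imset_card _ _) (leq_trans (leq_card_setU _ _) _).
  by rewrite leq_add ?leq_imset_card ?card_outside.
apply/hull_number_le/hull_setP=> T cT /subsetP ST.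
case/cprism_convexP: (cT) => _ _ _ h4 h5.
have UT x : x \notin C -> inr x \in T.
  by move=> xC; apply/ST/imset_f; rewrite !inE xC orbT.
(* The trace of [T] on the copy of [C]; rule 4 makes it convex in the induced complement. *)
pose A : {set induced (compl G) C} := [set x | inr (val x) \in T].
have cA : convex A.
  apply: cograph_convex; first exact/cograph_induced/cograph_compl.
  move=> x y z; rewrite !inE => xT yT nxy nadj xz zy.
  apply: (h4 (val x) (val y)) => //; move: nadj.
  by rewrite /= /induced_adj /= /compl_adj negb_and negbK (inj_eq val_inj) (negbTE nxy) negbK.
have SA : S \subset A.
  by apply/subsetP=> x xS; rewrite inE; apply/ST/imset_f; rewrite inE imset_f.
have inrT x : inr x \in T.
  case: (boolP (x \in C)) => xC; last exact: UT.
  by have := hS A cA SA (exist _ x xC); rewrite inE.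
have [c cC] := inside_neq0.
case=> x //; case: (boolP (x \in C)) => xC.
  by apply: (h5 x u) => //; apply: co_apart.
by apply: (h5 x c) => //; rewrite /co sgraph_connect_sym; apply: co_apart.
Qed.

(* A hull set of [G[C]] lifted to [G] misses the copy of [C] in the complement;
   moving one of its vertices [x0] there repairs this, since [inl x0] lies
   between [inr x0] and [inr u] for [u] outside [C]. *)
Lemma hull_number_cprism_le_induced :
  hull_number (cprism G)
  <= hull_number (induced G C) + #|trivial_components (compl G)|.
Proof.
have [S /hull_setP hS <-] := hull_number_attained (induced G C).
have [u uC] := outside_neq0.
have [c cC] := inside_neq0.
have [x0 x0S] : exists x0, x0 \in S.
  (* The empty set is convex, so it is no hull set of the nonempty graph on [C]. *)
  apply/set0Pn/eqP=> S0; have c0 : convex (set0 : {set induced G C}).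
    by apply/convexP=> x y z; rewrite inE.
  by have := hS set0 c0; rewrite S0 => /(_ (subxx _) (exist _ c cC)); rewrite inE.
pose Xl : {set G} := [set val x | x in S :\ x0].
pose Xr : {set G} := val x0 |: ~: C.
pose S' : {set cprism G} := [set inl x | x in Xl] :|: [set inr x | x in Xr].
apply: (@leq_trans #|S'|); last first.
  apply: leq_trans (leq_card_setU _ _) _.
  (* [x0] is counted once, in [Xr] instead of [Xl]. *)
  rewrite (cardsD1 x0) x0S -addnA addnCA leq_add //.
    by apply: leq_trans (leq_imset_card _ _) (leq_imset_card _ _).
  apply: leq_trans (leq_imset_card _ _) _; apply: leq_trans (leq_card_setU _ _) _.
  by rewrite cards1 leq_add2l card_outside.
apply/hull_number_le/hull_setP=> T cT /subsetP ST.
case/cprism_convexP: (cT) => h1 _ _ _ h5.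
have UT x : x \notin C -> inr x \in T.
  by move=> xC; apply/ST; rewrite inE [X in _ || X]imset_f ?orbT // !inE xC orbT.
have x0C : val x0 \in C := valP x0.
have x0T : inr (val x0) \in T.
  by apply/ST; rewrite inE [X in _ || X]imset_f ?orbT // setU11.
have x0Tl : inl (val x0) \in T by apply: (h5 _ u) => //; [exact: UT|exact: co_apart].
pose A : {set induced G C} := [set x | inl (val x) \in T].
have cA : convex A.
  apply: cograph_convex; first exact/cograph_induced.
  by move=> x y z; rewrite !inE => xT yT nxy nadj xz zy; apply: (h1 (val x) (val y)).
have SA : S \subset A.
  apply/subsetP=> x xS; rewrite inE; case: (eqVneq x x0) => [->//|nx].
  by apply/ST; rewrite inE imset_f // imset_f // !inE nx.
apply: cprism_spread => // x; case: (boolP (x \in C)) => xC.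
- by have := hS A cA SA (exist _ x xC); rewrite inE.
- apply: (h5 x (val x0)) => //; first exact: UT.
  by rewrite /co sgraph_connect_sym; apply: co_apart.
- by exists (val x0) => //; rewrite -co_inside.
- by exists x; [exact: UT | exact: connect0].
Qed.

End OneNontrivialCocomponent.

End ComplementaryPrism.

Theorem theorem7 (G : sgraph) (k t : nat) :
  connected G -> cograph G -> 1 < #|G| ->
  k = #|nontrivial_components (compl G)| ->
  t = #|trivial_components (compl G)| ->
  [/\ k = 0 -> hull_number (cprism G) = t,
      k = 1 -> forall C : {set G}, C \in nontrivial_components (compl G) ->
        t + 2 <= hull_number (cprism G)
        <= minn (hull_number (induced G C))
                (hull_number (induced (compl G) C)) + t
    & 2 <= k -> hull_number (cprism G) = k + t + 1].
Proof.
move=> coG cG G2 -> ->; split.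
- exact: hull_number_cprism_complete.
- move=> k1 C CN.
  have CE : nontrivial_components (compl G) = [set C].
    move/eqP/cards1P: k1 => [D DE]; by move: CN; rewrite DE inE => /eqP->.
  apply/andP; split.
    have [S hS <-] := hull_number_attained (cprism G).
    (* With [k = 1], [t + 2] is one more than the number [k + t] of co-components, so the strict
       lower bound applies. *)
    rewrite addnS addnC -{1}k1 card_components.
    by apply: ltn_components_hull_set => //; rewrite k1.
  rewrite addn_minl leq_min; apply/andP; split.
    exact: hull_number_cprism_le_induced.
  exact: hull_number_cprism_le_compl.
- by move=> k2; rewrite card_components; apply: hull_number_cprism_many.
Qed.
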